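(* Let $\epsilon>0$ and $m,n\in\mathbb{N}$, and let $\delta=\epsilon/\sqrt{8n\log(2mn)}$ (natural logarithm). Then every game in $L(n,m,\delta)$ admits a pure $\epsilon$-equilibrium.
   Context: An $n$-player game $G$ in normal form is given by finite strategy sets $A_1,\dots,A_n$ and payoff functions $f_i:A\to\mathbb{R}$, where $A=\prod_{i=1}^n A_i$; write $a=(a_i,a_{-i})$ with $a_{-i}\in A_{-i}=\prod_{j\ne i}A_j$. On $A_{-i}$ use the metric $\rho(a'_{-i},a''_{-i})=\#\{j\ne i: a'_j\ne a''_j\}$. The Lipschitz constant of $G$ is $\delta(G)=\max|f_i(a_i,a'_{-i})-f_i(a_i,a''_{-i})|$ over all players $i$, all $a_i\in A_i$ and all $a'_{-i},a''_{-i}$ with $\rho(a'_{-i},a''_{-i})=1$. $L(n,m,\delta)$ is the set of games with $n$ players, at most $m$ strategies for every player, and Lipschitz constant at most $\delta$. A pure $\epsilon$-equilibrium is a profile $a\in A$ with $f_i(d,a_{-i})\le f_i(a)+\epsilon$ for all players $i$ and all $d\in A_i$. *)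

(* Defs.v *)
From HB Require Import structures.
From mathcomp Require Import all_boot all_order all_algebra.
From mathcomp Require Import reals exp.

Set Implicit Arguments.
Unset Strict Implicit.
Unset Printing Implicit Defensive.

Import Order.TTheory GRing.Theory Num.Theory.

Local Open Scope ring_scope.

(* Strategy sets are nonempty, as usual for games in normal form. *)
Record game (R : realType) (n : nat) := Game {
  strategy : 'I_n -> finType;
  strategy_gt0 : forall i, (0 < #|strategy i|)%N;
  payoff : 'I_n -> {dffun forall i, strategy i} -> R
}.

Definition profile (R : realType) (n : nat) (G : game R n) :=
  {dffun forall i, strategy G i}.

(* The profile (d, a_{-i}). An element of A_{-i} is represented by any profile *)
(* extending it: [deviate] and [rho] ignore the coordinate i of the profile. *)
Definition deviate (R : realType) (n : nat) (G : game R n) (i : 'I_n)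
    (d : strategy G i) (a : profile G) : profile G :=
  finfun (dfwith a d).

Definition rho (R : realType) (n : nat) (G : game R n) (i : 'I_n)
    (a' a'' : profile G) : nat :=
  #|[set j : 'I_n | (j != i) && (a' j != a'' j)]|.

(* The default 0 only matters when no pair is at distance 1 (e.g. n = 1), in *)
(* which case the constant is 0; otherwise all the values are >= 0. *)
Definition lipschitz_constant (R : realType) (n : nat) (G : game R n) : R :=
  \big[Num.max/0]_(i < n) \big[Num.max/0]_(d : strategy G i)
    \big[Num.max/0]_(a' : profile G)
      \big[Num.max/0]_(a'' : profile G | rho i a' a'' == 1%N)
        `|payoff i (deviate d a') - payoff i (deviate d a'')|.

Definition lipschitz_games (R : realType) (n m : nat) (delta : R)
    (G : game R n) : Prop :=
  (forall i : 'I_n, (#|strategy G i| <= m)%N) /\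
  lipschitz_constant G <= delta.

Arguments lipschitz_games {R} n m delta G.

Definition pure_equilibrium (R : realType) (n : nat) (G : game R n) (eps : R)
    (a : profile G) : Prop :=
  forall (i : 'I_n) (d : strategy G i),
    payoff i (deviate d a) <= payoff i a + eps.

(* Main.v *)
Require Import Defs.
From HB Require Import structures.
From mathcomp Require Import all_boot all_order all_algebra.
From mathcomp Require Import reals exp.
From mathcomp Require Import boolp topology normedtype sequences.
From mathcomp Require Import ring lra.

(* Sample a profile from an (approximate) mixed Nash equilibrium. The payoff of *)
(* each pure strategy of each player is a Lipschitz function of the independent *)
(* choices of the other n - 1 players, so by Azuma's inequality and a union bound *)
(* over the at most mn pure strategies, with positive probability all these *)
(* payoffs are within almost eps / 2 of their expectations; as the sampled *)
(* strategies are approximate best replies to the mixed profile, the sampled *)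
(* profile is an eps-equilibrium. The constant leaves room, since n - 1 < n, for *)
(* an approximate equilibrium with additive error eps / 4n.  Its existence is *)
(* derived from a parity argument in the style of Scarf: for a finite set T with *)
(* a family of linear orders indexed by I and a colouring T -> I, some subset s *)
(* of T has the property that every point of T is, for some colour i occurring in s, *)
(* below all of s in the i-th order. On a grid of the simplex this is a discrete *)
(* form of the Knaster-Kuratowski-Mazurkiewicz lemma. *)

Set Implicit Arguments.
Unset Strict Implicit.
Unset Printing Implicit Defensive.

Import Order.TTheory GRing.Theory Num.Theory.
Import numFieldNormedType.Exports.

(** * Dominant sets and colourings *)

(** Write L = ln(2mn), so that delta^2 = eps^2/(8nL). With moment bounds of the form exp(l^2 b^2/2)
    per coordinate, the two-sided tail of a payoff at distance t from its mean is at most 2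
    exp(-t^2/(2n delta^2)); at t = eps/2 this is 2 exp(-L) = 1/(mn), just what a union bound over mn
    pure strategies can afford. That is the origin of the 8. If every payoff is within t of its
    mean, a deviation from a sampled strategy gains at most 2t plus the error of the mixed
    equilibrium.

    Expectations are finite iterated sums. [azuma_mgf] bounds the exponential moments, and
    [means_support] replaces the positive-probability argument: it picks, player by player, a
    charged strategy that keeps a function at or below its average.

    The mixed equilibrium is combinatorial. [door_degree] and [room_degree] are the local counts
    behind the parity theorem [dominant_colored]; [grid_kkm] applies it to one simplex over the pure
    strategies of all players together, and [approximate_nash] normalises the resulting weights
    player by player. *)

(** One value in excess means a single fibre with two elements and all others singletons. This is
    the source of the number 2 in [door_degree]. *)
Lemma imset_collision (I T : finType) (f : I -> T) (C : {set I}) :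
  #|C| = #|f @: C|.+1 ->
  exists i j, [/\ i \in C, j \in C, i != j, f i = f j &
    [/\ {in C :\ i &, injective f}, {in C :\ j &, injective f} &
        forall k, k \in C -> f @: (C :\ k) = f @: C -> k = i \/ k = j]].
Proof.
move=> cardC.
have injD k : k \in C -> f @: (C :\ k) = f @: C -> {in C :\ k &, injective f}.
  move=> kC imk; apply/imset_injP; rewrite imk.
  by have := cardsD1 k C; rewrite kC cardC add1n => -[->].
have imD k l : l \in C -> l != k -> f k = f l -> f @: (C :\ k) = f @: C.
  move=> lC lk fkl; apply/eqP; rewrite eqEsubset imsetS ?subsetDl //=.
  apply/subsetP=> _ /imsetP[x xC ->].
  have [->|xk] := eqVneq x k; first by rewrite fkl imset_f // !inE lk.
  by rewrite imset_f // !inE xk.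
have [i iC [j jC [ij fij]]] : exists2 i, i \in C & exists2 j, j \in C & i != j /\ f i = f j.
  have : ~~ dinjectiveb f (mem C).
    apply/negP=> /dinjectiveP /imset_injP /eqP cardE.
    by move: cardC; rewrite cardE => /eqP; rewrite ltn_eqF.
  case/dinjectivePn=> i iC [j]; rewrite !inE => /andP[ji jC] fij.
  by exists i => //; exists j => //; rewrite eq_sym.
exists i, j; split=> //; split.
- by apply: injD => //; apply: (imD i j) => //; rewrite eq_sym.
- by apply: injD => //; apply: (imD j i).
move=> k kC imk; have inj := injD k kC imk.
have [->|ki] := eqVneq k i; first by left.
have [->|kj] := eqVneq k j; first by right.
have := inj i j; rewrite !inE iC jC ![_ == k]eq_sym ki kj => /(_ isT isT fij) eij.
by rewrite eij eqxx in ij.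
Qed.

Section DominantPairs.
Variables (I T : finType) (r : I -> T -> nat).
Hypothesis r_inj : forall i, injective (r i).
Implicit Types (s : {set T}) (C : {set I}).

Definition dominant s C :=
  [forall y, [exists i in C, [forall x in s, r i y <= r i x]]].

Lemma dominantP s C :
  reflect (forall y, exists2 i, i \in C & {in s, forall x, r i y <= r i x})
          (dominant s C).
Proof.
apply: (iffP forallP) => dom y.
  by have /exists_inP[i iC /forall_inP le] := dom y; exists i.
by have [i iC le] := dom y; apply/exists_inP; exists i => //; apply/forall_inP.
Qed.

Arguments dominantP {s C}.

Lemma dominantS s s' C C' :
  s' \subset s -> C \subset C' -> dominant s C -> dominant s' C'.
Proof.
move=> /subsetP ss /subsetP CC /dominantP dom; apply/dominantP=> y.
by have [i iC le] := dom y; exists i => [|x xs]; [apply: CC | apply/le/ss].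
Qed.

(* The pairs (s, C) of [dominant s C] with #|s| = #|C| are rooms, those with *)
(* #|C| = #|s| + 1 are doors: every door with s nonempty bounds two rooms. *)
Definition room := [set p : {set T} * {set I} |
  dominant p.1 p.2 && (#|p.1| == #|p.2|)].

Definition incident (d p : {set T} * {set I}) :=
  (d.1 \subset p.1) && (p.2 \subset d.2).

Lemma incident_roomP s C p : #|C| = #|s|.+1 -> incident (s, C) p ->
  p \in room ->
  (exists2 k, k \in C & p = (s, C :\ k)) \/
  (exists2 y, y \notin s & p = (y |: s, C)).
Proof.
case: p => t D cC /andP[/= st DC]; rewrite inE /= => /andP[_ /eqP cE].
have := subset_leq_card st; rewrite leq_eqVlt => /orP[cst|cst].
  have /eqP ts : s == t by rewrite eqEcard st -(eqP cst) leqnn.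
  left; subst t; have : D \proper C by rewrite properEcard DC -cE cC ltnS leqnn.
  case/properP=> _ [k kC kD]; exists k => //; congr pair.
  apply/eqP; rewrite eqEcard subsetD1 DC kD /=.
  by have := cardsD1 k C; rewrite kC cC add1n => -[<-]; rewrite cE.
right; have DE : D = C.
  by apply/eqP; rewrite eqEcard DC cC -cE.
subst D; have : s \proper t by rewrite properEcard st.
case/properP=> _ [y yt ys]; exists y => //; congr pair; apply/eqP.
by rewrite eq_sym eqEcard subUset sub1set yt st /= cardsU1 ys cE cC add1n.
Qed.

Section Door.
Variables (s : {set T}) (C : {set I}) (x0 : T).
Hypotheses (x0s : x0 \in s) (cardC : #|C| = #|s|.+1) (dom : dominant s C).

Definition bottom k : T := [arg min_(x < x0 in s) r k x].

Lemma bottomP k : bottom k \in s /\ {in s, forall x, r k (bottom k) <= r k x}.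
Proof. by rewrite /bottom; case: arg_minnP. Qed.

Lemma bottom_uniq k x :
  x \in s -> {in s, forall z, r k x <= r k z} -> bottom k = x.
Proof.
move=> xs le; have [bs leb] := bottomP k.
by apply: (@r_inj k); apply/eqP; rewrite eqn_leq leb //= le.
Qed.

(** Dominance applied to a point of [s] itself says that this point is lowest in [s] for some index
    of [D]. *)
Lemma bottom_imset D : dominant s D -> bottom @: D = s.
Proof.
move/dominantP=> domD; apply/eqP; rewrite eqEsubset; apply/andP; split.
  by apply/subsetP=> _ /imsetP[k _ ->]; have [] := bottomP k.
apply/subsetP=> x xs; have [k kD le] := domD x.
by apply/imsetP; exists k => //; rewrite (bottom_uniq xs le).
Qed.

Definition above k y := [forall l in C :\ k, r l (bottom l) < r l y].

(** The pivot step: the room reached through the door when [k] is the index to be relieved of its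
    bottom element. *)
Definition opposite k : {set T} * {set I} :=
  if [pick y | above k y && [forall z, above k z ==> (r k z <= r k y)]] is Some y
  then (y |: s, C) else (s, C :\ k).

Lemma oppositeP k :
  (exists2 y, opposite k = (y |: s, C) &
     above k y /\ forall z, above k z -> r k z <= r k y) \/
  (opposite k = (s, C :\ k) /\ forall z, ~~ above k z).
Proof.
rewrite /opposite; case: pickP => [y /andP[ay /forallP mx]|no].
  by left; exists y => //; split=> // z az; apply: (implyP (mx z)).
right; split=> // z; apply/negP=> az; case: (arg_maxnP (r k) az) => y ay mx.
have := no y; rewrite /= ay /=; move/negP; apply; apply/forallP=> w.
by apply/implyP=> aw; apply: mx.
Qed.

Lemma opposite_above k y :
  above k y -> (forall z, above k z -> r k z <= r k y) ->
  opposite k = (y |: s, C).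
Proof.
move=> ay mx; case: (oppositeP k) => [[z -> [az mz]]|[_ /(_ y)]]; last by rewrite ay.
by congr (_ |: _, _); apply: (@r_inj k); apply/eqP; rewrite eqn_leq mx // mz.
Qed.

Lemma aboveP k y : reflect {in C :\ k, forall l, r l (bottom l) < r l y} (above k y).
Proof. exact: forall_inP. Qed.

Lemma above_notin k l y : k \in C -> l \in C -> k != l -> bottom k = bottom l ->
  above k y -> y \notin s.
Proof.
move=> kC lC kl bkl /aboveP ay; apply/negP=> ys.
have [h hC le] := dominantP dom y; have bh := bottom_uniq ys le.
have [hk|hk] := eqVneq h k; last by have := ay h; rewrite !inE hk hC bh ltnn => /(_ isT).
by have := ay l; rewrite !inE eq_sym kl lC -bkl -hk bh ltnn => /(_ isT).
Qed.

(** A point not above the bottoms of all indices other than [k] is dominated by one of those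
    indices. A point above them all can only be dominated through [k], which stays true after adding
    [y] because [y] is [k]-maximal among such points. *)
Lemma opposite_room k l : k \in C -> l \in C -> k != l -> bottom k = bottom l ->
  opposite k \in room /\ incident (s, C) (opposite k).
Proof.
move=> kC lC kl bkl; case: (oppositeP k) => [[y -> [ay mx]]|[-> no]].
  have ys := above_notin kC lC kl bkl ay.
  split; last by rewrite /incident /= subxx subsetUr.
  rewrite inE /= cardsU1 ys cardC add1n eqxx andbT; apply/dominantP=> z.
  have [az|/forall_inPn[h hC]] := boolP (above k z).
    have [h hC le] := dominantP dom z.
    have hk : h = k.
      apply/eqP/negPn/negP=> hk; have := forall_inP az h; rewrite !inE hk hC.
      by have [bs _] := bottomP h; rewrite ltnNge le // => /(_ isT).
    by exists k => // x; rewrite !inE => /orP[/eqP->|xs]; [apply: mx | rewrite -hk le].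
  rewrite -leqNgt => le; exists h; first by move: hC; rewrite inE => /andP[].
  move=> x; rewrite !inE => /orP[/eqP->|xs]; apply: leq_trans le _.
    exact/ltnW/(forall_inP ay).
  by have [_ ->] := bottomP h.
split; last by rewrite /incident /= subxx subsetDl.
rewrite inE /=; apply/andP; split; last first.
  by have := cardsD1 k C; rewrite kC cardC add1n => -[->].
apply/dominantP=> z; have /forall_inPn[h hC] := no z; rewrite -leqNgt => le.
by exists h => // x xs; apply: leq_trans le _; have [_ ->] := bottomP h.
Qed.

(** The converse of the pivot: [y] uses up the index [k], so the points of [s] must be bottoms of
    the other indices, and each of these bottoms lies strictly below [y]. *)
Lemma bottom_imset_add y k : y \notin s -> dominant (y |: s) C ->
  {in y |: s, forall x, r k y <= r k x} ->
  bottom @: (C :\ k) = s /\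
  {in s, forall x, exists2 l, l \in C :\ k & bottom l = x /\ r l x < r l y}.
Proof.
move=> ys domy lek.
have low x : x \in s -> exists2 l, l \in C :\ k & bottom l = x /\ r l x < r l y.
  move=> xs; have [l lC lel] := dominantP domy x.
  have xy : x != y by apply: contraNneq ys => <-.
  exists l; last split.
  - rewrite !inE lC andbT; apply: contraNneq xy => lk.
    apply/eqP/(@r_inj k); apply/eqP; rewrite eqn_leq lek ?inE ?xs ?orbT // andbT.
    by rewrite -lk lel ?setU11.
  - by apply: bottom_uniq => // z zs; apply: lel; rewrite inE zs orbT.
  - rewrite ltn_neqAle lel ?setU11 // andbT.
    by apply: contraNneq xy => /r_inj ->.
split=> //; apply/eqP; rewrite eqEsubset; apply/andP; split.
  by apply/subsetP=> _ /imsetP[l _ ->]; have [] := bottomP l.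
by apply/subsetP=> x /low[l lC [<- _]]; apply: imset_f.
Qed.

(* Exactly two indices k of C share their bottom element in s; each of them gives *)
(* one room: either k is dropped from C, or s gains the point that is k-maximal *)
(* among those above the bottoms of all the other indices. *)
Lemma door_degree : #|[set p in room | incident (s, C) p]| = 2.
Proof.
have imC := bottom_imset dom.
have := @imset_collision _ _ bottom C; rewrite imC => /(_ cardC).
move=> [i [j [iC jC ij bij [inji injj only]]]].
have ji : j != i by rewrite eq_sym.
have [ri ii] := opposite_room iC jC ij bij.
have [rj jj] := opposite_room jC iC ji (esym bij).
have neq : opposite i != opposite j.
  (* If both pivots add a point, it cannot be the same one: the index that dominates [y] differs
     from [i] or from [j], and there [y] would have to exceed a bottom. *)
  apply/eqP; have disj y : above i y -> ~~ above j y.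
    move=> /aboveP ai; apply/negP=> /aboveP aj; have [h hC le] := dominantP dom y.
    have [bs _] := bottomP h; have := le _ bs; apply/negP; rewrite -ltnNge.
    have [hi|hi] := eqVneq h i; last by apply: ai; rewrite !inE hi.
    by apply: aj; rewrite !inE hC andbT hi.
  case: (oppositeP i) => [[y -> [ay _]]|[-> _]];
    case: (oppositeP j) => [[z -> [az _]]|[-> _]] [].
  - move/setP/(_ y); rewrite !inE eqxx /=.
    rewrite (negbTE (above_notin iC jC ij bij ay)) orbF => /esym/eqP yz.
    by have := disj y ay; rewrite yz az.
  - by move=> _ /setP/(_ j); rewrite !inE eqxx jC.
  - by move=> _ /setP/(_ i); rewrite !inE eqxx iC.
  - by move/setP/(_ i); rewrite !inE eqxx iC ij.
suff -> : [set p in room | incident (s, C) p] = [set opposite i; opposite j].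
  by rewrite cards2 neq.
apply/setP=> p; apply/idP/idP; last first.
  by rewrite in_set2 inE => /orP[]/eqP->; rewrite ?ri ?rj.
rewrite inE => /andP[pr pin].
suff [k kij ->] : exists2 k, k = i \/ k = j & p = opposite k.
  by case: kij => ->; rewrite !inE eqxx ?orbT.
case: (incident_roomP cardC pin pr) => [[k kC pE]|[y ys pE]]; subst p.
  move: pr; rewrite inE => /andP[/= domk _].
  exists k; first by apply: only => //; rewrite (bottom_imset domk).
  case: (oppositeP k) => [[y _ [/aboveP ay _]]|[-> //]].
  have [h hC le] := dominantP domk y; have [bs _] := bottomP h.
  by have := ay h hC; rewrite ltnNge le.
move: pr; rewrite inE => /andP[/= domy _].
have [k kC lek] := dominantP domy y.
have [imk low] := bottom_imset_add ys domy lek.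
have kij : k = i \/ k = j by apply: only => //; rewrite imk.
have injk : {in C :\ k &, injective bottom} by case: kij => ->.
have ay : above k y.
  apply/aboveP=> l lC; have [bs _] := bottomP l.
  by have [h hC [bh lt]] := low _ bs; rewrite -(injk _ _ hC lC bh) bh.
exists k => //; rewrite (opposite_above ay) // => z az.
have [h hC le] := dominantP domy z.
have [<-|hk] := eqVneq h k; first by rewrite le ?setU11.
have [bs _] := bottomP h.
have := le (bottom h); rewrite inE bs orbT => /(_ isT); rewrite leqNgt.
by rewrite (forall_inP az) // !inE hk.
Qed.

End Door.

(** The empty set with one index is the exceptional door: dropping the index leaves nothing to
    dominate [x1], so only the [i]-maximal point can be added. *)
Lemma corner_degree (x1 : T) i :
  #|[set p in room | incident (set0, [set i]) p]| = 1.
Proof.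
case: (@arg_maxnP _ x1 xpredT (r i)) => // x _ mx'; have mx y : r i y <= r i x by apply: mx'.
suff -> : [set p in room | incident (set0, [set i]) p] = [set ([set x], [set i])].
  by rewrite cards1.
apply/setP=> p; rewrite in_set1 inE; apply/andP/eqP=> [[pr pin]|->]; last first.
  rewrite /incident /= sub0set subxx inE /= !cards1 eqxx andbT; split=> //.
  by apply/dominantP=> y; exists i; rewrite ?set11 // => _ /set1P->; apply: mx.
have cE : #|[set i]| = #|set0 : {set T}|.+1 by rewrite cards1 cards0.
case: (incident_roomP cE pin pr) => [[k /set1P-> pE]|[y _ pE]]; subst p.
  move: pr; rewrite inE /= => /andP[/dominantP/(_ x1)[h]].
  by rewrite setDv inE.
move: pr; rewrite inE /= setU0 => /andP[/dominantP/(_ x)[h /set1P->]].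
move=> /(_ y (set11 _)) le _; congr pair; congr [set _].
by apply: (@r_inj i); apply/eqP; rewrite eqn_leq le mx.
Qed.

(** * Parity argument for coloured doors and rooms *)

Section Coloring.
Variables (c : T -> I) (i0 : I).

Definition good_door := [set d : {set T} * {set I} |
  [&& dominant d.1 d.2, #|d.2| == #|d.1|.+1, i0 \in d.2 & c @: d.1 == d.2 :\ i0]].

Lemma good_doorP s C : (s, C) \in good_door ->
  [/\ dominant s C, #|C| = #|s|.+1, i0 \in C, c @: s = C :\ i0 &
      {in s &, injective c}].
Proof.
rewrite inE /= => /and4P[dom /eqP cC iC /eqP im]; split=> //.
apply/imset_injP; rewrite im; have := cardsD1 i0 C.
by rewrite iC cC add1n => -[->].
Qed.

Lemma incident_doorP d t D : d \in good_door -> incident d (t, D) ->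
  (t, D) \in room ->
  (exists2 k, k \notin D & d = (t, k |: D)) \/
  (exists2 y, y \in t & d = (t :\ y, D)).
Proof.
case: d => s C /good_doorP[_ cC _ _ _] pin pr.
case: (incident_roomP cC pin pr) => [[k kC [-> ->]]|[y ys [-> ->]]].
  by left; exists k; rewrite ?setD11 ?setD1K.
by right; exists y; rewrite ?setU11 ?setU1K.
Qed.

(** The number of such doors is 0 or 2. Either an index [k] can be added and the point coloured [k]
    can also be removed, or the doors arise by removing one of two points of the same colour. *)
Lemma room_degree p : p \in room -> c @: p.1 != p.2 ->
  2 %| #|[set d in good_door | incident d p]|.
Proof.
case: p => t D pr /= cne; have := pr; rewrite inE /= => /andP[domD /eqP cD].
have removeP y : y \in t -> i0 \in D -> c @: (t :\ y) = D :\ i0 ->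
    (t :\ y, D) \in [set d in good_door | incident d (t, D)].
  move=> yt iD im; rewrite !inE /= im eqxx iD -cD /incident /= subxx subsetDl !andbT.
  rewrite (dominantS _ _ domD) ?subsetDl //=.
  by have := cardsD1 y t; rewrite yt add1n => ->.
have [|no] := boolP [exists k, (k \notin D) && ((t, k |: D) \in good_door)].
  case/existsP=> k /andP[kD gk]; have [_ cC iC im inj] := good_doorP gk.
  have ki : k != i0.
    by apply: contraNneq cne => ki; rewrite im -ki setU1K.
  have iD : i0 \in D by move: iC; rewrite !inE eq_sym (negbTE ki).
  have /imsetP[y yt ky] : k \in c @: t by rewrite im !inE ki eqxx.
  suff -> : [set d in good_door | incident d (t, D)] =
            [set (t, k |: D); (t :\ y, D)].
    rewrite cards2; case: eqP => // -[_ /setP/(_ k)].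
    by rewrite !inE eqxx (negbTE kD).
  apply/setP=> d; rewrite in_set2; apply/idP/orP=> [|[]/eqP->]; last first.
  - apply: removeP => //; apply/setP=> e; apply/imsetP/idP=> [[x]|].
      rewrite !inE => /andP[xy xt] ->.
      have := imset_f c xt; rewrite im !inE => /andP[-> /orP[/eqP cx|->//]].
      by rewrite (inj x y) ?eqxx // in xy; rewrite cx.
    rewrite !inE => /andP[ei eD].
    have : e \in c @: t by rewrite im !inE ei eD orbT.
    case/imsetP=> x xt ex; exists x => //; rewrite !inE xt andbT.
    by apply: contraNneq kD => xy; rewrite ky -xy -ex.
  - by rewrite inE gk /incident /= subxx subsetUr.
  rewrite inE => /andP[gd pin].
  case: (incident_doorP gd pin pr) => [[l lD dE]|[z zt dE]]; subst d.
    left; have [_ _ _ im' _] := good_doorP gd.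
    have : k \in c @: t by rewrite im !inE ki eqxx.
    by rewrite im' !inE (negbTE kD) orbF => /andP[_ /eqP->].
  right; have [_ _ _ im' _] := good_doorP gd.
  have [->//|yz] := eqVneq y z.
  have : k \in c @: (t :\ z) by rewrite ky imset_f // !inE yz.
  by rewrite im' !inE (negbTE kD) andbF.
have [->|[d]] := set_0Vmem [set d in good_door | incident d (t, D)].
  by rewrite cards0.
rewrite inE => /andP[gd pin].
case: (incident_doorP gd pin pr) => [[k kD dE]|[y yt dE]]; subst d.
  by case/existsP: no; exists k; rewrite kD.
have [_ cC iD im inj] := good_doorP gd.
have imt : c @: t = c y |: (D :\ i0) by rewrite -im -imsetU1 setD1K.
have yi : c y != i0.
  by apply: contraNneq cne => ci; rewrite imt ci setD1K.
(* Otherwise adding the colour of [y] to [D] would give a good door, against [no]. Hence another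
   point [z] of the room has that colour. *)
have kD : c y \in D.
  apply: contraR no => kD; apply/existsP; exists (c y); rewrite kD inE /=.
  rewrite (dominantS _ _ domD) ?subsetUr //= cardsU1 kD cD add1n eqxx !inE iD orbT /=.
  by rewrite imt; apply/eqP/setP=> e; rewrite !inE; case: eqVneq => // ->; rewrite yi.
have /imsetP[z] : c y \in c @: (t :\ y) by rewrite im !inE yi.
rewrite !inE => /andP[zy zt] cyz.
suff -> : [set d in good_door | incident d (t, D)] =
          [set (t :\ y, D); (t :\ z, D)].
  rewrite cards2; case: eqP => // -[/setP/(_ y)].
  by rewrite !inE eqxx yt eq_sym zy.
apply/setP=> d; rewrite in_set2; apply/idP/orP=> [|[]/eqP->]; last first.
- apply: removeP => //; rewrite -im; apply/setP=> e.
  apply/imsetP/imsetP=> -[x]; rewrite !inE => /andP[xn xt] ->.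
    have [->|xy] := eqVneq x y; first by exists z => //; rewrite !inE zy.
    by exists x => //; rewrite !inE xy.
  have [->|xz] := eqVneq x z; first by exists y => //; rewrite !inE eq_sym zy.
  by exists x => //; rewrite !inE xz.
- by rewrite inE gd.
rewrite inE => /andP[gd' pin'].
case: (incident_doorP gd' pin' pr) => [[l lD dE]|[w wt dE]]; subst d.
  by case/existsP: no; exists l; rewrite lD.
have [_ _ _ _ inj'] := good_doorP gd'.
have [->|wy] := eqVneq w y; first by left.
have [->|wz] := eqVneq w z; first by right.
have := inj' y z; rewrite !inE ![_ == w]eq_sym wy wz yt zt => /(_ isT isT cyz).
by move=> yz; rewrite yz eqxx in zy.
Qed.

(** Incidences of good doors and rooms are counted twice. Without a completely coloured room each
    room contributes an even number, while each good door contributes 2 except the corner with index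
    [i0], which contributes 1. *)
Theorem dominant_colored (x1 : T) : exists s, dominant s (c @: s).
Proof.
have [/existsP//|/existsPn no] := boolP [exists s, dominant s (c @: s)].
pose deg d := #|[set p in room | incident d p]|.
have degE d : deg d = \sum_(p in room) incident d p.
  rewrite /deg -sum1_card big_mkcond [RHS]big_mkcond; apply: eq_bigr => p _.
  by rewrite inE; case: (p \in room) => //=; case: incident.
have : 2 %| \sum_(d in good_door) deg d.
  under eq_bigr do rewrite degE.
  rewrite exchange_big; apply: dvdn_sum => p pr.
  have -> : \sum_(d in good_door) incident d p = #|[set d in good_door | incident d p]|.
    rewrite -sum1_card big_mkcond [RHS]big_mkcond; apply: eq_bigr => d _.
    by rewrite inE; case: (d \in good_door) => //=; case: incident.
  apply: room_degree => //; apply/negP=> /eqP pE.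
  by move: pr; rewrite inE -pE (negbTE (no _)).
rewrite (bigD1 (set0, [set i0])) /=; last first.
  rewrite inE /= cards1 cards0 set11 imset0 setDv !eqxx !andbT.
  by apply/dominantP=> y; exists i0; rewrite ?set11 // => x; rewrite inE.
rewrite [deg _](corner_degree x1) dvdn_addl //; apply: dvdn_sum => -[s C].
case/andP=> /good_doorP[dom cC iC im _] ne.
have [s0|[x xs]] := set_0Vmem s; last by rewrite /deg (door_degree xs).
case/eqP: ne; rewrite s0; congr pair; apply/eqP.
by rewrite eq_sym eqEcard sub1set iC cards1 cC s0 cards0.
Qed.

End Coloring.
End DominantPairs.

(** * A discrete Knaster-Kuratowski-Mazurkiewicz lemma *)

Theorem grid_kkm (I : finType) (K : nat) (c : {ffun I -> nat} -> I) (i0 : I) :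
  exists q : {ffun I -> nat},
  [/\ \sum_i q i <= K, K < \sum_i q i + #|I| &
      forall i, 0 < q i -> exists w : {ffun I -> nat},
        [/\ forall j, q j <= w j, \sum_j w j = K & c w = i]].
Proof.
pose P (w : {ffun I -> 'I_K.+1}) := \sum_i w i == K :> nat.
pose T : finType := {w | P w}.
pose coord (w : T) : {ffun I -> nat} := [ffun i => val (val w i)].
have sum_coord w : \sum_i coord w i = K.
  by rewrite -[RHS](eqP (valP w)); apply: eq_bigr => i _; rewrite ffunE.
have gridP (g : I -> nat) : \sum_i g i = K -> exists w : T, forall i, coord w i = g i.
  move=> sg; have lt i : g i < K.+1 by rewrite ltnS -sg (bigD1 i) //= leq_addr.
  have sw : P [ffun i => Ordinal (lt i)].
    by apply/eqP; rewrite -[RHS]sg; apply: eq_bigr => i _; rewrite ffunE.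
  by exists (exist P _ sw) => i; rewrite !ffunE.
(* Ties in a coordinate are broken by an arbitrary enumeration. *)
pose r i (w : T) := coord w i * #|T| + enum_rank w.
have r_inj i : injective (r i).
  move=> w w' /(congr1 (modn^~ #|T|)); rewrite /r !modnMDl !modn_small ?ltn_ord //.
  by move/val_inj/enum_rank_inj.
have r_lt i w w' : coord w i < coord w' i -> r i w < r i w'.
  move=> lt; rewrite /r; apply: leq_trans (leq_addr _ _).
  apply: leq_trans (leq_mul lt (leqnn _)).
  by rewrite mulSn addnC ltn_add2r ltn_ord.
have [x1 _] : exists w : T, forall i, coord w i = if i == i0 then K else 0.
  by apply: gridP; rewrite -big_mkcond big_pred1_eq.
have [s /dominantP dom] := dominant_colored r_inj (c \o coord) i0 x1.
have [x0 x0s] : exists x, x \in s.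
  have [s0|[x xs]] := set_0Vmem s; last by exists x.
  by have [i] := dom x1; rewrite s0 imset0 inE.
set C := (_ @: s) in dom.
pose low i := [arg min_(x < x0 in s) coord x i].
have lowP i : low i \in s /\ {in s, forall x, coord (low i) i <= coord x i}.
  by rewrite /low; case: arg_minnP.
(* The coordinatewise minimum of [s], cut to 0 off the colours of [s], so that a positive coordinate
   is always the colour of some point of [s]. *)
pose q := [ffun i => if i \in C then coord (low i) i else 0].
have q_le x i : x \in s -> q i <= coord x i.
  by move=> xs; rewrite ffunE; case: ifP => // _; apply: (lowP i).2.
exists q; split.
- by rewrite -(sum_coord x0); apply: leq_sum => i _; apply: q_le.
(* If one unit could be added to every coordinate of [q], some grid point would exceed the minimum
   of [s] strictly in every colour of [s] and be dominated by none. *)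
- rewrite ltnNge; apply/negP=> le.
  have [y yE] : exists w : T, forall i, coord w i =
      q i + 1 + (if i == i0 then K - (\sum_i q i + #|I|) else 0).
    apply: gridP; rewrite !big_split /= sum1_card -big_mkcond big_pred1_eq.
    by rewrite subnKC.
  have [i iC ley] := dom y; have [ls _] := lowP i.
  have := ley _ ls; rewrite leqNgt r_lt // yE [q i]ffunE iC addn1.
  by rewrite addSn ltnS leq_addr.
- move=> i; rewrite ffunE; case: ifP => // /imsetP[x xs ->] _.
  by exists (coord x); split=> // j; apply: q_le.
Qed.

Local Open Scope ring_scope.

(** * Concentration for product distributions *)

Lemma leq_exp2_fact k : (2 ^ k * k`! <= (k.*2)`!)%N.
Proof.
elim: k => // k IH; rewrite doubleS !factS expnS mulnACA -doubleS.
rewrite -[k.+1.*2]mul2n leq_mul2l /=.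
by apply: leq_trans IH _; rewrite leq_pmull.
Qed.

(** Termwise comparison of power series: odd terms cancel, and the even ones are compared using 2^k
    k! <= (2k)!. *)
Lemma expR_cosh_le (R : realType) (y : R) :
  expR y + expR (- y) <= 2 * expR (y ^+ 2 / 2).
Proof.
set z := y ^+ 2 / 2.
have z0 : 0 <= z by rewrite divr_ge0 // sqr_ge0.
have partial_le n : series (exp_coeff z) n <= expR z.
  apply: nondecreasing_cvgn_le; last exact: is_cvg_series_exp_coeff.
  apply/nondecreasing_seqP => k; rewrite /series /= big_nat_recr //= lerDl.
  exact: exp_coeff_ge0.
pose pair k : R := exp_coeff y k + exp_coeff (- y) k.
have pair_odd k : pair k.*2.+1 = 0.
  rewrite /pair /exp_coeff /= exprNn -signr_odd /= odd_double expr1.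
  by rewrite mulN1r mulNr subrr.
have pair_even k : pair k.*2 <= 2 * exp_coeff z k.
  rewrite /pair /exp_coeff /= exprNn -signr_odd odd_double expr0 mul1r -mulr2n.
  rewrite -[X in X <= _]mulr_natl ler_pM2l // /z expr_div_n -exprM mul2n -mulrA.
  rewrite ler_wpM2l //; first by rewrite -mul2n exprM exprn_ge0 // sqr_ge0.
  rewrite -invfM lef_pV2 ?posrE ?ltr0n ?fact_gt0 //; last first.
    by rewrite mulr_gt0 ?exprn_gt0 // ltr0n fact_gt0.
  by rewrite -natrX -natrM ler_nat leq_exp2_fact.
have pair_sum n : \sum_(0 <= k < n) pair k <= 2 * series (exp_coeff z) (uphalf n).
  rewrite /series /=; have [h nE] : exists h, n = h.*2 \/ n = h.*2.+1.
    exists n./2; have := odd_double_half n.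
    by case: (odd n) => /= nE; [right|left]; rewrite -{1}nE.
  have even h' : \sum_(0 <= k < h'.*2) pair k <= 2 * \sum_(0 <= k < h') exp_coeff z k.
    elim: h' => [|h' IH]; first by rewrite !big_geq // mulr0.
    rewrite doubleS !big_nat_recr //= pair_odd addr0 mulrDr.
    exact: lerD.
  case: nE => ->; first by rewrite uphalf_double.
  rewrite /= doubleK big_nat_recr //= big_nat_recr //= mulrDr.
  exact: lerD.
have cy := @is_cvg_series_exp_coeff R y.
have cNy := @is_cvg_series_exp_coeff R (- y).
apply: (cvgr_to_le (cvgD cy cNy)); apply: nearW => n /=.
rewrite [X in X <= _](_ : _ = \sum_(0 <= k < n) pair k); last by rewrite big_split.
by apply: le_trans (pair_sum n) _; rewrite ler_pM2l.
Qed.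

(** The tangent line of the exponential at the mean lies below its graph; averaging it gives the
    bound. *)
Lemma expR_jensen (R : realType) (D : finType) (p X : D -> R) :
  (forall d, 0 <= p d) -> \sum_d p d = 1 ->
  expR (\sum_d p d * X d) <= \sum_d p d * expR (X d).
Proof.
move=> p0 p1; set mu := \sum_d p d * X d.
have -> : expR mu = \sum_d p d * (expR mu * (1 + (X d - mu))).
  rewrite (eq_bigr (fun d => expR mu * (p d * (1 - mu) + p d * X d))).
    by rewrite -mulr_sumr big_split /= -mulr_suml p1 -/mu mul1r subrK mulr1.
  by move=> d _; ring.
apply: ler_sum => d _; apply: ler_wpM2l => //.
rewrite -{2}[X d](addrNK mu) expRD mulrC; apply: ler_wpM2r; first exact: expR_ge0.
exact: expR_ge1Dx.
Qed.

(* Symmetrization: the mean is replaced by an independent copy of X by Jensen. *)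
Lemma hoeffding_mgf (R : realType) (D : finType) (p X : D -> R) (b l : R) :
  (forall d, 0 <= p d) -> \sum_d p d = 1 ->
  (forall d d', `|X d - X d'| <= b) ->
  \sum_d p d * expR (l * X d) <=
  expR (l * (\sum_d p d * X d) + l ^+ 2 / 2 * b ^+ 2).
Proof.
move=> p0 p1 Xb; set mu := \sum_d p d * X d.
have jen : expR (- (l * mu)) <= \sum_d p d * expR (- (l * X d)).
  apply: le_trans (expR_jensen _ p0 p1); rewrite ler_expR mulr_sumr -sumrN.
  by apply: ler_sum => d _; rewrite mulrN lerN2 mulrCA.
rewrite expRD -(ler_pM2l (expR_gt0 (- (l * mu)))) mulrA -expRD addNr expR0 mul1r.
set S := \sum_d p d * expR (l * X d).
have S0 : 0 <= S by apply: sumr_ge0 => d _; rewrite mulr_ge0 // expR_ge0.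
apply: le_trans (ler_wpM2r S0 jen) _.
pose Z d d' := p d * p d' * expR (l * (X d - X d')).
have SE : (\sum_d p d * expR (- (l * X d))) * S = \sum_d \sum_d' Z d' d.
  rewrite mulr_suml; apply: eq_bigr => d _; rewrite /S mulr_sumr.
  by apply: eq_bigr => d' _; rewrite /Z mulrBr expRD; ring.
rewrite SE -(ler_pM2l (ltr0n R 2)) mulr_natl mulr2n {2}exchange_big /= -big_split /=.
have -> : 2 * expR (l ^+ 2 / 2 * b ^+ 2) =
    \sum_d \sum_d' p d * p d' * (2 * expR (l ^+ 2 / 2 * b ^+ 2)).
  under eq_bigr do rewrite -mulr_suml -mulr_sumr p1 mulr1.
  by rewrite -mulr_suml p1 mul1r.
apply: ler_sum => d _; rewrite -big_split /=; apply: ler_sum => d' _.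
rewrite /Z [p d' * _]mulrC -mulrDr; apply: ler_wpM2l; first by rewrite mulr_ge0.
rewrite -[X d - X d']opprB mulrN; apply: le_trans (expR_cosh_le _) _.
rewrite ler_pM2l // ler_expR exprMn mulrAC ler_wpM2l //.
  by rewrite divr_ge0 // sqr_ge0.
rewrite -[X in X <= _]real_normK ?num_real // ler_pXn2r ?nnegrE //.
exact: le_trans (Xb d d').
Qed.

(** * Product weights: perturbation, exponential moments and support *)

Section ProductWeights.
Variables (R : realType) (n : nat) (G : game R n).
Implicit Types (a : profile G) (F : profile G -> R) (s : seq 'I_n).

Lemma deviate_same i (d : strategy G i) a : deviate d a i = d.
Proof. by rewrite ffunE dfwith_in. Qed.

Lemma deviate_other i j (d : strategy G i) a : j != i -> deviate d a j = a j.
Proof. by move=> ji; rewrite ffunE dfwith_out // eq_sym. Qed.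

Lemma deviate_eq i (d : strategy G i) a a' :
  (forall j, j != i -> a j = a' j) -> deviate d a = deviate d a'.
Proof.
move=> eqa; apply/ffunP=> j; have [->|ji] := eqVneq j i.
  by rewrite !deviate_same.
by rewrite !deviate_other ?eqa.
Qed.

Lemma deviate_id i a : deviate (a i) a = a.
Proof.
apply/ffunP=> j; have [->|ji] := eqVneq j i; first by rewrite deviate_same.
by rewrite deviate_other.
Qed.

(* Expectation under a product of weights is an iterated one-player average, *)
(* which makes the martingale argument an induction on the list of players. *)
Definition pure_strategy : finType := {i : 'I_n & strategy G i}.
Implicit Types w p q : pure_strategy -> R.

Definition pure i (d : strategy G i) : pure_strategy := Tagged (fun i => strategy G i) d.

Definition mass w i : R := \sum_(d : strategy G i) w (pure d).

Definition mean w i F a : R := \sum_(d : strategy G i) w (pure d) * F (deviate d a).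

Definition means w s F : profile G -> R := foldr (mean w) F s.

Definition mixed p := (forall e, 0 <= p e) /\ (forall i, mass p i = 1).

Definition variation (b : 'I_n -> R) F := forall j a a',
  (forall k, k != j -> a k = a' k) -> `|F a - F a'| <= b j.

Lemma sum_mass w : \sum_i mass w i = \sum_e w e.
Proof.
rewrite /mass (sig_big_dep (fun=> true) (fun _ _ => true) (fun i d => w (pure d))) /=.
by apply: eq_bigr => -[i d] _.
Qed.

Lemma mean_le w i F F' a : (forall e, 0 <= w e) -> (forall a, F a <= F' a) ->
  mean w i F a <= mean w i F' a.
Proof. by move=> w0 le; apply: ler_sum => d _; apply: ler_wpM2l. Qed.

Lemma means_le w s F F' a : (forall e, 0 <= w e) -> (forall a, F a <= F' a) ->
  means w s F a <= means w s F' a.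
Proof. by move=> w0 le; elim: s a => //= i s IH a; apply: mean_le. Qed.

Lemma means_sum (E : finType) w s (F : E -> profile G -> R) a :
  means w s (fun a => \sum_e F e a) a = \sum_e means w s (F e) a.
Proof.
elim: s a => //= i s IH a; rewrite /mean exchange_big; apply: eq_bigr => d _.
by rewrite IH mulr_sumr.
Qed.

Lemma meansZ w s (k : R) F a : means w s (fun a => k * F a) a = k * means w s F a.
Proof.
elim: s a => //= i s IH a; rewrite /mean mulr_sumr; apply: eq_bigr => d _.
by rewrite IH mulrCA.
Qed.

Lemma meansD w s F F' a :
  means w s (fun a => F a + F' a) a = means w s F a + means w s F' a.
Proof.
elim: s a => //= i s IH a; rewrite /mean -big_split; apply: eq_bigr => d _.
by rewrite IH mulrDr.
Qed.

Lemma means_scale q p (k : 'I_n -> R) s F a :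
  (forall i (d : strategy G i), q (pure d) = k i * p (pure d)) ->
  means q s F a = (\prod_(i <- s) k i) * means p s F a.
Proof.
move=> qE; elim: s a => [a|i s IH a] /=; first by rewrite big_nil mul1r.
rewrite big_cons /mean mulr_sumr; apply: eq_bigr => d _.
by rewrite IH qE; ring.
Qed.

Lemma means_norm w s F (M : R) a : (forall e, 0 <= w e) ->
  (forall i, mass w i <= 1) -> (forall a, `|F a| <= M) -> `|means w s F a| <= M.
Proof.
move=> w0 w1 FM; have M0 : 0 <= M by apply: le_trans (FM a).
elim: s a => //= i s IH a; apply: le_trans (ler_norm_sum _ _ _) _.
apply: (@le_trans _ _ (mass w i * M)); last by rewrite ler_piMl.
rewrite mulr_suml; apply: ler_sum => d _.
by rewrite normrM ger0_norm // ler_wpM2l.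
Qed.

(** A telescoping over the players: replacing the weights of one player costs at most [M] times the
    mass removed, as all other masses are at most 1. *)
Lemma means_perturb x q s F (M : R) a : (forall e, 0 <= q e <= x e) ->
  (forall i, mass x i <= 1) -> (forall a, `|F a| <= M) ->
  `|means x s F a - means q s F a| <= M * \sum_(i <- s) (mass x i - mass q i).
Proof.
move=> qx x1 FM; have M0 : 0 <= M by apply: le_trans (FM a).
have q0 e : 0 <= q e by case/andP: (qx e).
have x0 e : 0 <= x e by case/andP: (qx e) => q0' /(le_trans q0').
have q1 i : mass q i <= 1.
  by apply: le_trans (x1 i); apply: ler_sum => d _; case/andP: (qx (pure d)).
elim: s a => [a|i s IH a] /=; first by rewrite subrr normr0 big_nil mulr0.
set D := \sum_(j <- s) _ in IH.
rewrite big_cons -/D mulrDr [X in _ <= X]addrC /mean -sumrB.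
have MD0 : 0 <= M * D by apply: le_trans (IH a).
apply: (@le_trans _ _ (mass x i * (M * D) + (mass x i - mass q i) * M)); last first.
  by rewrite [M * (_ - _)]mulrC lerD ?ler_piMl.
rewrite /mass -sumrB !mulr_suml -big_split /=.
apply: le_trans (ler_norm_sum _ _ _) _; apply: ler_sum => d _.
set A := means x s F _; set B := means q s F _.
have -> : x (pure d) * A - q (pure d) * B = x (pure d) * (A - B) + (x (pure d) - q (pure d)) * B.
  by ring.
have /andP[_ qxd] := qx (pure d).
apply: le_trans (ler_normD _ _) _; rewrite !normrM (ger0_norm (x0 _)).
rewrite (ger0_norm (x := x _ - q _)) ?subr_ge0 //.
apply: lerD; first by apply: ler_wpM2l; [exact: x0 | exact: IH].
by apply: ler_wpM2l; [rewrite subr_ge0 | exact: means_norm].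
Qed.

Lemma variation_mean p i b F : mixed p -> variation b F -> variation b (mean p i F).
Proof.
move=> [p0 p1] vF j a a' eqa; rewrite /mean -sumrB.
apply: le_trans (ler_norm_sum _ _ _) _.
rewrite -[b j]mul1r -(p1 i) mulr_suml; apply: ler_sum => d _.
rewrite -mulrBr normrM ger0_norm // ler_wpM2l //; apply: vF => k kj.
have [->|ki] := eqVneq k i; first by rewrite !deviate_same.
by rewrite !deviate_other // eqa.
Qed.

Lemma variation_means p s b F : mixed p -> variation b F -> variation b (means p s F).
Proof. by move=> mp vF; elim: s => //= i s IH; apply: variation_mean. Qed.

(** Averaging over later players does not increase the variation in the coordinate of player [i], so
    [hoeffding_mgf] contributes one factor per player. *)
Lemma azuma_mgf p s b F (l : R) a : mixed p -> variation b F ->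
  means p s (fun a => expR (l * F a)) a <=
  expR (l * means p s F a + l ^+ 2 / 2 * \sum_(i <- s) b i ^+ 2).
Proof.
move=> mp vF; have [p0 p1] := mp; elim: s a => [a|i s IH a] /=.
  by rewrite big_nil mulr0 addr0.
apply: le_trans (mean_le _ _ p0 IH) _; rewrite big_cons mulrDr addrA.
set V := l ^+ 2 / 2 * \sum_(j <- s) b j ^+ 2.
have -> : mean p i (fun a => expR (l * means p s F a + V)) a =
    (\sum_(d : strategy G i) p (pure d) * expR (l * means p s F (deviate d a))) * expR V.
  by rewrite mulr_suml; apply: eq_bigr => d _; rewrite expRD mulrA.
rewrite [X in _ <= X]expRD; apply: ler_wpM2r; first exact: expR_ge0.
apply: hoeffding_mgf => [d||d d']; [exact: p0|exact: p1|].
by apply: (variation_means s mp vF) => k ki; rewrite !deviate_other.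
Qed.

Lemma mean_support p i F a : mixed p ->
  exists2 d : strategy G i, 0 < p (pure d) & F (deviate d a) <= mean p i F a.
Proof.
move=> [p0 p1]; apply: contrapT => no.
have lt (d : strategy G i) : 0 < p (pure d) -> mean p i F a < F (deviate d a).
  by move=> pd; rewrite ltNge; apply/negP=> le; apply: no; exists d.
have [d pd] : exists d : strategy G i, 0 < p (pure d).
  apply: contrapT => nop; have := p1 i; rewrite /mass big1 => [/esym/eqP|d _].
    by rewrite oner_eq0.
  apply/eqP; rewrite eq_le p0 andbT leNgt; apply/negP=> pd.
  by apply: nop; exists d.
suff : mean p i F a < mean p i F a by rewrite ltxx.
rewrite -{1}[mean p i F a]mul1r -{1}(p1 i) mulr_suml [X in _ < X]/mean.
rewrite (bigD1 d) // [X in _ < X](bigD1 d) //= ltr_leD ?ltr_pM2l ?lt //.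
apply: ler_sum => d' _; have := p0 (pure d'); rewrite le_eqVlt => /orP[/eqP<-|pd'].
  by rewrite !mul0r.
by rewrite ler_pM2l // ltW // lt.
Qed.

(** The method of conditional expectations, fixing one player at a time by [mean_support]. *)
Lemma means_support p s F a : mixed p ->
  exists a', [/\ F a' <= means p s F a, forall i, i \in s -> 0 < p (pure (a' i)) &
                 forall i, i \notin s -> a' i = a i].
Proof.
move=> mp; elim: s a => [a|i s IH a] /=; first by exists a.
have [d pd led] := mean_support i (means p s F) a mp.
have [a' [le sup out]] := IH (deviate d a); exists a'; split.
- exact: le_trans led.
- move=> j; rewrite inE => /orP[/eqP->|]; last exact: sup.
  by have [/sup//|/out->] := boolP (i \in s); rewrite deviate_same.
- by move=> j; rewrite inE negb_or => /andP[ji /out->]; rewrite deviate_other.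
Qed.

End ProductWeights.

(** * Approximate mixed equilibria and sampling *)

Definition deviation_payoff (R : realType) (n : nat) (G : game R n) (i : 'I_n)
    (d : strategy G i) (a : profile G) : R := payoff i (deviate d a).

(* A grid point is coloured by a player of least total weight together with a *)
(* best reply of that player; [grid_kkm] then yields weights which have almost *)
(* the same mass for all players and charge only approximate best replies. *)
Theorem approximate_nash (R : realType) (n : nat) (G : game R n)
    (a0 : profile G) (eta : R) : (0 < n)%N -> 0 < eta ->
  exists2 p : pure_strategy G -> R, mixed p &
    forall (i : 'I_n) (d d' : strategy G i), 0 < p (pure d) ->
      means p (index_enum 'I_n) (deviation_payoff d') a0 <=
      means p (index_enum 'I_n) (deviation_payoff d) a0 + eta.
Proof.
move=> n0 eta0; set s := index_enum 'I_n; pose i0 := Ordinal n0.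
pose M : R := 1 + \sum_i \sum_(a : profile G) `|payoff i a|.
have M0 : 0 < M.
  by rewrite ltr_wpDr // sumr_ge0 // => i _; apply: sumr_ge0 => a _.
have payM i (d : strategy G i) a : `|deviation_payoff d a| <= M.
  rewrite /M (bigD1 i) //= (bigD1 (deviate d a)) //= /deviation_payoff.
  have : 0 <= \sum_(a' | a' != deviate d a) `|payoff i a'| by apply: sumr_ge0.
  have : 0 <= \sum_(j | j != i) \sum_(a : profile G) `|payoff j a|.
    by apply: sumr_ge0 => j _; apply: sumr_ge0.
  by set A := \sum_(j | _) _; set B := \sum_(j | _) _; lra.
(* [kappa] will bound the mass of each player from below, and [sigma] bounds the total mass lost
   between a grid point and [q]. The first bound on [sigma] serves the masses; the second makes the
   payoff error 2 M sigma negligible after division by a product of [n] masses. *)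
pose kappa : R := (2 * n%:R)^-1.
have nR : 1 <= n%:R :> R by rewrite ler1n.
have kappa0 : 0 < kappa by rewrite invr_gt0; lra.
have kappa_n : 2 * kappa * n%:R = 1 by rewrite /kappa; field; lra.
have kappa_le : kappa <= 1 / 2 by nra.
pose sigma : R := Num.min (kappa / 2) (eta * kappa ^+ n / (2 * M)).
have sigma0 : 0 < sigma.
  by rewrite lt_min !divr_gt0 ?mulr_gt0 ?exprn_gt0.
have sigma_kappa : sigma <= kappa / 2 by rewrite ge_min lexx.
have sigma_eta : 2 * M * sigma <= eta * kappa ^+ n.
  by rewrite mulrC -ler_pdivlMr ?mulr_gt0 // ge_min lexx orbT.
pose N := #|pure_strategy G|; pose K := (Num.truncn (N%:R / sigma : R)).+1.
have K0 : 0 < K%:R :> R by rewrite ltr0n.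
have NK : N%:R / K%:R <= sigma.
  rewrite ler_pdivrMr // mulrC -ler_pdivrMr // ltW //.
  by have /andP[] := truncn_itv (divr_ge0 (ler0n R N) (ltW sigma0)).
pose x (w : {ffun pure_strategy G -> nat}) e : R := (w e)%:R / K%:R.
pose U w i (d : strategy G i) := means (x w) s (deviation_payoff d) a0.
pose P w (e : pure_strategy G) :=
  (forall j, mass (x w) (tag e) <= mass (x w) j) /\
  (forall d', U w (tag e) d' <= U w (tag e) (tagged e)).
have [c cP] : {c & forall w, P w (c w)}.
  apply: choice => w; case: (@arg_minP _ _ _ i0 xpredT (mass (x w))) => // i _ mi.
  case: (@arg_maxP _ _ _ (a0 i) xpredT (U w i)) => // d _ md.
  by exists (pure d); split=> [j|d']; [apply: mi | apply: md].
have [q [sq Kq hq]] := grid_kkm K c (pure (a0 i0)).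
have x_ge0 w e : 0 <= x w e by rewrite divr_ge0.
have sum_x w : \sum_i mass (x w) i = (\sum_e w e)%:R / K%:R.
  by rewrite sum_mass -mulr_suml natr_sum.
have mass_ge0 w i : 0 <= mass (x w) i by apply: sumr_ge0.
have sum_q : 1 - sigma <= \sum_i mass (x q) i.
  apply: (@le_trans _ _ (1 - N%:R / K%:R)); first lra.
  rewrite sum_x -{1}(divff (lt0r_neq0 K0)) -mulrBl ler_pM2r ?invr_gt0 //.
  by rewrite lerBlDr -natrD ler_nat ltnW.
have closeP (w : {ffun pure_strategy G -> nat}) : (forall e, (q e <= w e)%N) -> (\sum_e w e)%N = K ->
    [/\ forall e, 0 <= x q e <= x w e, forall i, mass (x w) i <= 1,
        forall i, mass (x q) i <= mass (x w) i &
        \sum_i (mass (x w) i - mass (x q) i) <= sigma].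
  move=> qw sw; have sum1 : \sum_i mass (x w) i = 1.
    by rewrite sum_x sw divff // lt0r_neq0.
  have le e : x q e <= x w e by rewrite ler_pM2r ?invr_gt0 // ler_nat.
  split=> [e|i|i|]; first by rewrite x_ge0 le.
  - by rewrite -sum1 (bigD1 i) //= lerDl; apply: sumr_ge0.
  - by apply: ler_sum => d _; apply: le.
  - by rewrite sumrB sum1 lerBlDr addrC -lerBlDr.
(* The heaviest player [i] has mass at least (1 - sigma)/n and charges some strategy, so at some
   grid point [w] above [q] this player is the lightest. Thus [j] weighs at least as much as [i] at
   [w], and loses at most [sigma] in passing to [q]. *)
have mass_q j : kappa <= mass (x q) j.
  case: (@arg_maxP _ _ _ i0 xpredT (mass (x q))) => // i _ mi.
  have mi' : 1 - sigma <= mass (x q) i * n%:R.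
    apply: le_trans sum_q _; rewrite mulr_natr -[n in _ *+ n]card_ord -sumr_const.
    by apply: ler_sum => k _; apply: mi.
  have mi0 : 0 < mass (x q) i by nra.
  have [d qd] : exists d : strategy G i, (0 < q (pure d))%N.
    apply: contrapT => no; move: mi0; rewrite /mass big1 ?ltxx // => d _.
    rewrite /x; case: (posnP (q (pure d))) => [->|qd]; first by rewrite mul0r.
    by case: no; exists d.
  have [w [qw sw cw]] := hq _ qd; have [_ _ lew close] := closeP w qw sw.
  have [minw _] := cP w; rewrite cw /= in minw.
  have : mass (x w) j - mass (x q) j <= sigma.
    apply: le_trans close; rewrite (bigD1 j) //= lerDl; apply: sumr_ge0 => k _.
    by rewrite subr_ge0.
  have := minw j; have := lew i; move: mi' kappa_n.
  set A := mass _ i; set B := mass _ j; set A' := mass _ i; set B' := mass _ j.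
  nra.
have mass_q0 i : 0 < mass (x q) i by apply: lt_le_trans (mass_q i).
pose p e := x q e / mass (x q) (tag e).
have mp : mixed p.
  split=> [e|i]; first by rewrite divr_ge0 // ltW.
  by rewrite /mass /p /= -mulr_suml -/(mass (x q) i) divff // lt0r_neq0.
exists p => // i d d' pd.
have qd : (0 < q (pure d))%N.
  by move: pd; rewrite /p /x; case: posnP => // ->; rewrite !mul0r ltxx.
have [w [qw sw cw]] := hq _ qd; have [le01 w1 _ close] := closeP w qw sw.
have [_ best] := cP w; rewrite cw /= in best.
(* The strategy [d] is an exact best reply at [w]; the comparison moves to [q] at the cost of two
   such errors, and to the normalised [p] on dividing by [pi]. *)
have near (e : strategy G i) : `|U w i e - U q i e| <= M * sigma.
  apply: le_trans (means_perturb _ _ le01 w1 (payM _ _)) _.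
  by rewrite ler_wpM2l // ltW.
have qE j (e : strategy G j) : x q (pure e) = mass (x q) j * p (pure e).
  by rewrite /p /= mulrC divfK // lt0r_neq0.
set E := means p s (deviation_payoff d) a0; set E' := means p s _ a0.
set pi := \prod_(j <- s) mass (x q) j.
have UE : U q i d = pi * E by apply: means_scale.
have UE' : U q i d' = pi * E' by apply: means_scale.
have pi_ge : kappa ^+ n <= pi.
  rewrite -[n in _ ^+ n]card_ord -prodr_const.
  by apply: ler_prod => j _; rewrite mass_q ltW.
have pi0 : 0 < pi by apply: lt_le_trans pi_ge; apply: exprn_gt0.
rewrite -(ler_pM2l pi0) mulrDr -UE -UE'.
have := best d'; have := near d; have := near d'; rewrite !ler_norml.
move=> /andP[h1 h2] /andP[h3 h4] h5.
have : eta * kappa ^+ n <= pi * eta by rewrite mulrC ler_pM2r.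
lra.
Qed.

(** The own coordinate is overwritten by [d], hence variation 0 there; this is why only [n - 1]
    players count in the tail bound. *)
Lemma deviation_variation (R : realType) (n : nat) (G : game R n) (delta : R)
    (i : 'I_n) (d : strategy G i) : lipschitz_constant G <= delta ->
  variation (fun j => if j == i then 0 else delta) (deviation_payoff d).
Proof.
move=> /bigmax_leP[delta0 /(_ i isT)/bigmax_leP[_ /(_ d isT)/bigmax_leP[_ lip]]] j a a' eqa.
rewrite /deviation_payoff.
have [eq_off|] := boolP [forall k, (k != i) ==> (a k == a' k)].
  rewrite (@deviate_eq _ _ _ _ d a a') => [|k ki].
    by rewrite subrr normr0; case: ifP.
  by apply/eqP/(implyP (forallP eq_off k)).
case/forallPn=> k; rewrite negb_imply => /andP[ki ak].
have kj : k = j by apply/eqP; apply: contraNT ak => /eqa->.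
subst k; rewrite (negbTE ki).
have /bigmax_leP[_ /(_ a')] := lip a isT; apply.
suff -> : rho i a a' = #|[set j]| by rewrite cards1.
rewrite /rho; congr #|pred_of_set _|; apply/setP=> k; rewrite !inE.
have [->|kj] := eqVneq k j; first by rewrite ki ak.
by rewrite eqa // eqxx andbF.
Qed.

(** Both tails, obtained from the parameters [l] and [- l], are put in one function so that a single
    average controls them. *)
Lemma azuma_tail_mgf (R : realType) (n : nat) (G : game R n)
    (p : pure_strategy G -> R) s b F (l t : R) a : mixed p -> variation b F ->
  means p s (fun a' => expR (l * (F a' - means p s F a - t)) +
                       expR (l * (means p s F a - F a' - t))) a <=
  2 * expR (l ^+ 2 / 2 * (\sum_(i <- s) b i ^+ 2) - l * t).
Proof.
move=> mp vF; set m := means p s F a; set V := l ^+ 2 / 2 * _.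
have side l' : l' ^+ 2 = l ^+ 2 ->
    means p s (fun a' => expR (- (l' * m) - l * t) * expR (l' * F a')) a <=
    expR (V - l * t).
  move=> ll; rewrite meansZ.
  apply: le_trans (ler_wpM2l (expR_ge0 _) (azuma_mgf s l' a mp vF)) _.
  by rewrite ll -expRD -/m -/V ler_expR; lra.
have h1 := side l erefl; have h2 := side (- l) (sqrrN l).
rewrite mulr_natl mulr2n; apply: le_trans (lerD h1 h2); rewrite -meansD.
apply: means_le => [|a']; first by case: mp.
rewrite -!expRD lerD // ler_expR; nra.
Qed.

Theorem theorem1 (R : realType) (eps : R) (m n : nat) (heps : 0 < eps)
    (G : game R n)
    (hG : lipschitz_games n m
            (eps / Num.sqrt (8 * n%:R * ln (2 * m%:R * n%:R))) G) :
  exists a : profile G, pure_equilibrium eps a.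
Proof.
have [cardG lipG] := hG; have [a0] : inhabited (profile G).
  constructor; exact (finfun (fun i => enum_val (Ordinal (strategy_gt0 G i)))).
have [n0|n0] := posnP n.
  by exists a0 => i; have := ltn_ord i; rewrite {2}n0.
have m0 : (0 < m)%N.
  exact: leq_trans (strategy_gt0 G (Ordinal n0)) (cardG _).
set L := ln _ in lipG; set delta := _ / _ in lipG.
have nR : 1 <= n%:R :> R by rewrite ler1n.
have mR : 1 <= m%:R :> R by rewrite ler1n.
have mn1 : 1 < 2 * m%:R * n%:R :> R by nra.
have L0 : 0 < L by apply: ln_gt0.
have delta2 : delta ^+ 2 * (8 * n%:R * L) = eps ^+ 2.
  have nL0 : 0 < 8 * n%:R * L by rewrite !mulr_gt0 //; lra.
  by rewrite /delta expr_div_n sqr_sqrtr ?(ltW nL0) // divfK // lt0r_neq0.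
(* Here 2t + eta = eps, and [l] is the optimal parameter t/(n delta^2) for t = eps/2. Having [n - 1]
   terms instead of [n] gains L/n in the exponent and [eta] costs L/(2n), which leaves -L -
   L/(2n). *)
pose eta := eps / (4 * n%:R); pose t := (eps - eta) / 2; pose l := 4 * L / eps.
have eta0 : 0 < eta by rewrite divr_gt0 //; lra.
have [p mp nash] := approximate_nash a0 n0 eta0; set s := index_enum 'I_n in nash.
pose F (e : pure_strategy G) := deviation_payoff (tagged e).
pose mu e := means p s (F e) a0.
(* The union bound as one function: its average is below 1, and where it is below 1 every
   exponential is too, so every exponent is negative and every payoff is within [t] of its mean. *)
pose bad a := \sum_e (expR (l * (F e a - mu e - t)) + expR (l * (mu e - F e a - t))).
have bad_mean : means p s bad a0 < 1.
  rewrite /bad means_sum.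
  have tail e : means p s (fun a => expR (l * (F e a - mu e - t)) +
      expR (l * (mu e - F e a - t))) a0 <= 2 * expR (- L - L / (2 * n%:R)).
    apply: le_trans (azuma_tail_mgf _ _ _ _ mp (deviation_variation (tagged e) lipG)) _.
    rewrite ler_pM2l // ler_expR (bigD1 (tag e)) //= eqxx expr0n add0r.
    rewrite (eq_bigr (fun=> delta ^+ 2)) => [|j /negbTE->//].
    rewrite sumr_const cardC1 card_ord -[_ *+ n.-1]mulr_natr -subn1 natrB //.
    have -> : delta ^+ 2 = eps ^+ 2 / (8 * n%:R * L).
      by rewrite -delta2 mulfK // !mulf_neq0 //; lra.
    rewrite le_eqVlt; apply/orP; left; apply/eqP.
    by rewrite /l /t /eta; field; rewrite !lt0r_neq0 //; lra.
  apply: (@le_lt_trans _ _ (\sum_(e : pure_strategy G) 2 * expR (- L - L / (2 * n%:R)))).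
    by apply: ler_sum => e _; apply: tail.
  rewrite sumr_const -[_ *+ #|_|]mulr_natl.
  have expL : expR (- L) = (2 * m%:R * n%:R)^-1.
    by rewrite expRN lnK // posrE; lra.
  have lt : expR (- L - L / (2 * n%:R)) < (2 * m%:R * n%:R)^-1.
    by rewrite -expL ltr_expR gtrDl oppr_lt0 divr_gt0 //; lra.
  have cardI : (#|pure_strategy G| <= m * n)%N.
    rewrite card_tagged sumnE big_map big_enum mulnC -[X in (_ <= X * _)%N]card_ord.
    by rewrite -sum_nat_const; apply: leq_sum => i _; apply: cardG.
  apply: (@le_lt_trans _ _ ((m * n)%:R * (2 * expR (- L - L / (2 * n%:R))))).
    by rewrite ler_wpM2r ?mulr_ge0 ?expR_ge0 // ler_nat.
  rewrite [ltRHS](_ : 1 = (m * n)%:R * (2 * (2 * m%:R * n%:R)^-1)); last first.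
    by rewrite natrM; field; rewrite !lt0r_neq0 //; lra.
  by rewrite ltr_pM2l ?ltr_pM2l // ltr0n muln_gt0 m0.
have [a [bad_a sup _]] := means_support s bad a0 mp.
have l0 : 0 < l by rewrite divr_gt0 // mulr_gt0.
have conc e : `|F e a - mu e| <= t.
  have : expR (l * (F e a - mu e - t)) + expR (l * (mu e - F e a - t)) < 1.
    apply: le_lt_trans (le_lt_trans bad_a bad_mean); rewrite /bad (bigD1 e) //= lerDl.
    by apply: sumr_ge0 => e' _; rewrite addr_ge0 ?expR_ge0.
  set A := expR _; set B := expR _ => AB.
  have A0 : 0 < A := expR_gt0 _; have B0 : 0 < B := expR_gt0 _.
  have A1 : A < expR 0 by rewrite expR0; lra.
  have B1 : B < expR 0 by rewrite expR0; lra.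
  move: A1 B1; rewrite !ltr_expR !pmulr_rlt0 // ler_norml => ? ?.
  by apply/andP; split; lra.
exists a => i d.
(* The strategy [a i] is charged by [p], hence an [eta]-best reply in the mean; the two deviations
   from the mean add at most [2 * t]. *)
have := nash i (a i) d (sup i (mem_index_enum i)).
have := conc (pure d); have := conc (pure (a i)); rewrite !ler_norml.
rewrite /mu /F /= /deviation_payoff /= deviate_id => /andP[h1 h2] /andP[h3 h4] h5.
rewrite /t in h1 h2 h3 h4; lra.
Qed.
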